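(* Let $\mathcal{S}=\langle a_1,\ldots,a_n\rangle\subset\mathbb{N}^m$ be a semigroup with a unique Betti element $b\in\mathbb{N}^m$, $b\neq 0$, and let $d$ be the dimension of the $\mathbb{Q}$-vector space spanned by $a_1,\ldots,a_n$. Then, for all $x\in\mathbb{Z}^m$, $$\mu_{\mathcal{S}}(x)=\sum_{j=1}^{t}(-1)^{|A_j|}\binom{k_{A_j}+n-d-1}{k_{A_j}},$$ where $\{A_1,\ldots,A_t\}$ (with $A_1,\ldots,A_t$ distinct) is the set of all subsets $A\subset\{1,\ldots,n\}$ for which there exists $k_A\in\mathbb{N}$ such that $x-\sum_{i\in A}a_i=k_A\,b$.
   Context: $\mathbb{N}=\{0,1,2,\ldots\}$. For nonzero vectors $a_1,\ldots,a_n\in\mathbb{N}^m$, $\mathcal{S}=\langle a_1,\ldots,a_n\rangle=\{x_1a_1+\cdots+x_na_n \mid x_1,\ldots,x_n\in\mathbb{N}\}$. Since $\mathcal{S}\cap(-\mathcal{S})=\{0\}$, the relation $x\leq_{\mathcal{S}}y \iff y-x\in\mathcal{S}$ is a locally finite partial order on $\mathbb{Z}^m$. For $l\geq 0$ let $c_l(x,y)$ be the number of chains $x=z_0<_{\mathcal{S}}z_1<_{\mathcal{S}}\cdots<_{\mathcal{S}}z_l=y$ of length $l$ in $\mathbb{Z}^m$; the Möbius function of $\mathcal{S}$ is $\mu_{\mathcal{S}}(x):=\sum_{l\ge 0}(-1)^l c_l(0,x)$ for $x\in\mathbb{Z}^m$ (a finite sum). Let $k$ be a field. The toric ideal $I_{\mathcal{S}}\subset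 k[x_1,\ldots,x_n]$ is the kernel of the $k$-algebra map $k[x_1,\ldots,x_n]\to k[t_1^{\pm1},\ldots,t_m^{\pm1}]$ sending $x_i$ to $\mathbf{t}^{a_i}$ (where $\mathbf{t}^{b}=t_1^{b_1}\cdots t_m^{b_m}$). The $\mathcal{S}$-degree of a monomial $x_1^{\alpha_1}\cdots x_n^{\alpha_n}$ is $\sum_i\alpha_ia_i$, and a polynomial is $\mathcal{S}$-homogeneous of $\mathcal{S}$-degree $b$ if all its monomials have $\mathcal{S}$-degree $b$. The semigroup $\mathcal{S}$ has a unique Betti element $b\in\mathbb{N}^m$ if $I_{\mathcal{S}}$ is generated by a set of $\mathcal{S}$-homogeneous polynomials of common $\mathcal{S}$-degree $b$. Convention: when $n=d$ the binomial coefficient $\binom{k-1}{k}$ equals $1$ for $k=0$ and $0$ for $k\geq1$. *)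

(* Defs.v *)
From mathcomp Require Import all_boot all_order all_algebra.
From mathcomp Require Import finmap mpoly.
From mathcomp Require Import boolp classical_sets cardinality fsbigop.

Set Implicit Arguments.
Unset Strict Implicit.
Unset Printing Implicit Defensive.

Import GRing.Theory.

Local Open Scope classical_set_scope.
Local Open Scope ring_scope.

Definition natZ (m : nat) (v : 'rV[nat]_m) : 'rV[int]_m := map_mx Posz v.

Definition natQ (m : nat) (v : 'rV[nat]_m) : 'rV[rat]_m :=
  map_mx (fun k : nat => k%:R) v.

Section Semigroup.
Variables (m n : nat) (a : 'I_n -> 'rV[nat]_m).

Definition sdeg (alpha : 'X_{1..n}) : 'rV[nat]_m := \sum_(i < n) a i *+ alpha i.

Definition semigroup : set 'rV[int]_m := [set x | exists alpha, x = natZ (sdeg alpha)].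

Definition le_semi (x y : 'rV[int]_m) : Prop := semigroup (y - x).

Definition lt_semi : rel 'rV[int]_m := fun x y => `[< le_semi x y /\ x <> y >].

(* A chain x = z_0 < z_1 < ... < z_l = y is encoded by (z_1, ..., z_l). *)
Definition chains (l : nat) (x y : 'rV[int]_m) : set (l.-tuple 'rV[int]_m) :=
  [set z | path lt_semi x z /\ last x z = y].

(* The cardinality is the genuine one and the sum over all l has finite support
   when every a i is nonzero: each step of a chain then increases the sum of the
   coordinates, and the z_i lie in a bounded box. *)
Definition mobius (x : 'rV[int]_m) : int :=
  \sum_(l \in [set: nat]) (-1) ^+ l * #|` fset_set (@chains l 0 x)|%:Z.

Definition rank_semi : nat := \dim <<[seq natQ (a i) | i <- enum 'I_n]>>%VS.

End Semigroup.

Section Toric.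
Variables (K : fieldType) (m n : nat) (a : 'I_n -> 'rV[nat]_m).

(* The Laurent polynomial ring K[t_1^{+-1}, ..., t_m^{+-1}] is the subring of
   K(t_1, ..., t_m) generated by the constants and the monomials t^v, v in Z^m;
   taking the whole fraction field as codomain does not change the kernel. *)
Definition laurent_mono (v : 'rV[int]_m) : {fraction {mpoly K[m]}} :=
  \prod_(j < m) (tofrac ('X_j : {mpoly K[m]})) ^ v ord0 j.

Definition toric_map (p : {mpoly K[n]}) : {fraction {mpoly K[m]}} :=
  mmap (fun c : K => tofrac (c%:MP : {mpoly K[m]}))
       (fun i => laurent_mono (natZ (a i))) p.

Definition toric_ideal : set {mpoly K[n]} := [set p | toric_map p = 0].

Definition shomog (b : 'rV[nat]_m) (p : {mpoly K[n]}) : Prop :=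
  forall alpha : 'X_{1..n}, alpha \in msupp p -> sdeg a alpha = b.

Definition ideal_generated (G : set {mpoly K[n]}) : set {mpoly K[n]} :=
  [set p | exists s : seq ({mpoly K[n]} * {mpoly K[n]}),
     (forall c, c \in s -> G c.2) /\ p = \sum_(c <- s) c.1 * c.2].

Definition unique_betti (b : 'rV[nat]_m) : Prop :=
  exists G : set {mpoly K[n]},
    (forall g, G g -> shomog b g) /\ toric_ideal = ideal_generated G.

End Toric.

Section BettiMultiples.
Variables (m n : nat) (a : 'I_n -> 'rV[nat]_m) (b : 'rV[nat]_m) (x : 'rV[int]_m).

Definition betti_multiple (A : {set 'I_n}) (k : nat) : Prop :=
  x - \sum_(i in A) natZ (a i) = natZ b *+ k.

(* For b <> 0 there is at most one such k; the default 0 is only returned when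
   there is none. *)
Definition kcoef (A : {set 'I_n}) : nat := xget 0%N [set k | betti_multiple A k].

End BettiMultiples.

(* Main.v *)
(** Let [u_0, ..., u_r] be the factorizations of [b] in [N^n].  Two of them cannot
    share a generator: cancelling it would give a binomial in the toric ideal of
    degree strictly below [b].  Hence their supports are disjoint, the differences
    [u_i - u_0] form a basis of the lattice of relations, so [r = n - d], and each
    element of the semigroup has exactly one factorization divisible by none of
    [u_1, ..., u_r].  If [G] counts factorizations and [D_v f x = f x - f (x - v)],
    then [D_(a_1) ... D_(a_n) G] is the delta function at [0] and [D_b^r G] is the
    indicator of the semigroup.  Convolution with the Moebius function sends that
    indicator to the delta function, whence
    [D_b^r mu = D_(a_1) ... D_(a_n) delta], and [D_b] is injective on functions
    supported in the positive half space.  The right-hand side of the theorem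
    solves the same equation, since the negative binomial coefficients invert
    [D_b^r]. *)
Require Import Defs.
From mathcomp Require Import all_boot all_order all_algebra.
From mathcomp Require Import boolp.
From mathcomp Require Import finmap mpoly classical_sets cardinality fsbigop.
From mathcomp Require Import zify ring.

Import Order.TTheory GRing.Theory Num.Theory.

Local Open Scope ring_scope.
Local Open Scope classical_set_scope.

(** * Difference operators *)

Section Difference.
Variable V : zmodType.
Implicit Types (v x : V) (f g : V -> int).

Definition diff v f : V -> int := fun x => f x - f (x - v).

Definition diffs (vs : seq V) f : V -> int := foldr diff f vs.

Lemma diffC v w f : diff v (diff w f) = diff w (diff v f).
Proof. by apply/funext => x; rewrite /diff (addrAC x (- v)); ring. Qed.

Lemma diffsC v vs f : diff v (diffs vs f) = diffs vs (diff v f).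
Proof. by elim: vs => //= w vs IH; rewrite diffC IH. Qed.

Lemma diffs_catC vs ws f : diffs vs (diffs ws f) = diffs ws (diffs vs f).
Proof. by elim: vs => //= v vs ->; rewrite diffsC. Qed.

(** Difference operators are translation invariant, so they pass through any combination of
    translates; this serves both for convolutions with [mobius] and for the right-hand side of the
    theorem. *)
Lemma diffs_sum (I : Type) (s : seq I) (P : pred I) (c : I -> int) (h : I -> V)
    vs f x :
  diffs vs (fun y => \sum_(i <- s | P i) c i * f (y - h i)) x
    = \sum_(i <- s | P i) c i * diffs vs f (x - h i).
Proof.
elim: vs x => //= v vs IH x; rewrite /diff !IH -sumrB.
by apply: eq_bigr => i _; rewrite -mulrBr (addrAC x).
Qed.

(** Expansion of the product of the factors $1 - T_{h_i}$, where $T_v$ is translation by $v$: the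
    set [A] records the factors from which $-T_{h_i}$ is taken. *)
Lemma diffs_subsets (I : finType) (h : I -> V) f x :
  diffs [seq h i | i <- enum I] f x
    = \sum_(A : {set I}) (-1) ^+ #|A| * f (x - \sum_(i in A) h i).
Proof.
have H (s : seq I) : uniq s -> diffs [seq h i | i <- s] f x
    = \sum_(A : {set I} | A \subset s) (-1) ^+ #|A| * f (x - \sum_(i in A) h i).
  elim: s x => [|i s IH] x /=.
    move=> _; rewrite (big_pred1 finset.set0) => [|A /=].
      by rewrite cards0 mul1r big_set0 subr0.
    by rewrite -finset.subset0; apply: eq_subset_r => j; rewrite !inE.
  case/andP => iNs us.
  rewrite (bigID (fun A : {set I} => i \in A)) /= addrC /diff !IH //.
  congr (_ + _).
    apply: eq_bigl => A; apply/idP/andP => [/fintype.subsetP As|[/fintype.subsetP As iA]].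
      split; first by apply/fintype.subsetP => j /As; rewrite inE orbC => ->.
      by apply: contra iNs => /As.
    apply/fintype.subsetP => j jA; have := As _ jA; rewrite inE => /orP[/eqP ji|//].
    by rewrite -ji jA in iA.
  (* The sets containing [i] are the [i |: A] with [A] inside [s]; they account for the translated
     term of the new difference. *)
  rewrite [RHS](reindex_onto (fun A : {set I} => i |: A)%SET (fun A => A :\ i)%SET) /=;
    last by move=> A /andP[_ iA]; rewrite finset.setD1K.
  rewrite -sumrN; apply: eq_big => [A|A As].
    rewrite !inE eqxx /= andbT; apply/idP/andP => [As|[/fintype.subsetP As /eqP iA]].
      have iA : i \notin A.
        by apply: contra iNs => iA; move/fintype.subsetP: As; apply.
      rewrite finset.setU1K //; split=> //; apply/fintype.subsetP => j.
      rewrite !inE => /orP[->//|jA].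
      by move/fintype.subsetP: As => /(_ _ jA) ->; rewrite orbT.
    apply/fintype.subsetP => j jA.
    have : j \in (i |: A)%SET by rewrite !inE jA orbT.
    move=> /As; rewrite inE => /orP[/eqP ji|//].
    by move: jA; rewrite -iA ji !inE eqxx.
  have iA : i \notin A by apply: contra iNs => iA; move/fintype.subsetP: As; apply.
  by rewrite cardsU1 iA big_setU1 //= exprS opprD addrA mulN1r mulNr.
rewrite H ?enum_uniq //; apply: eq_bigl => A.
by apply/fintype.subsetP => j _; rewrite mem_enum.
Qed.

End Difference.

Arguments diff {V} v f _.
Arguments diffs {V} vs f _.

(** * Counting factorizations *)

Section Factorizations.
Variables (m n : nat) (a : 'I_n -> 'rV[nat]_m).
Implicit Types (al be u v : 'X_{1..n}) (x : 'rV[int]_m).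

Lemma natZD (v w : 'rV[nat]_m) : natZ (v + w) = natZ v + natZ w.
Proof. by apply/matrixP => i j; rewrite !mxE PoszD. Qed.

Lemma natZ0 : natZ (0 : 'rV[nat]_m) = 0.
Proof. by apply/matrixP => i j; rewrite !mxE. Qed.

Lemma natZ_inj : injective (@natZ m).
Proof.
move=> v w /matrixP H; apply/matrixP => i j.
by have := H i j; rewrite !mxE => -[].
Qed.

Lemma natZ_eq0 (v : 'rV[nat]_m) : (natZ v == 0) = (v == 0).
Proof. by rewrite -natZ0 (inj_eq natZ_inj). Qed.

Lemma sdegD al be : sdeg a (al + be)%MM = sdeg a al + sdeg a be.
Proof. by rewrite /sdeg -big_split; apply: eq_bigr => i _; rewrite mnmDE mulrnDr. Qed.

Lemma sdeg0 : sdeg a 0%MM = 0.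
Proof. by rewrite /sdeg big1 // => i _; rewrite mnm0E. Qed.

Lemma sdeg1 i : sdeg a U_(i)%MM = a i.
Proof.
rewrite /sdeg (bigD1 i) //= mnm1E eqxx mulr1n big1 ?addr0 // => j ji.
by rewrite mnm1E eq_sym (negbTE ji).
Qed.

Lemma sdegE al i j : sdeg a al i j = (\sum_k a k i j * al k)%N.
Proof.
rewrite /sdeg summxE; apply: eq_bigr => k _; rewrite mulmxnE.
by elim: (al k) => [|p IH]; rewrite ?muln0 ?mulr0n // mulnS mulrS IH.
Qed.

(** Row vectors over [nat] have no subtraction, so the cancellation is carried out over the
    integers. *)
Lemma sdegIr u al be :
  sdeg a (al + u)%MM = sdeg a (be + u)%MM -> sdeg a al = sdeg a be.
Proof.
move=> h; apply/natZ_inj/(addIr (natZ (sdeg a u))).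
by rewrite -!natZD -!sdegD h.
Qed.

Lemma semigroup0 : semigroup a 0.
Proof. by exists 0%MM; rewrite sdeg0 natZ0. Qed.

Lemma semigroupD x y : semigroup a x -> semigroup a y -> semigroup a (x + y).
Proof. by move=> [al ->] [be ->]; exists (al + be)%MM; rewrite sdegD natZD. Qed.

(** An additive grading, positive on nonzero semigroup elements; it bounds chains and drives the
    inductions on [x]. *)
Definition weight x : int := \sum_j x ord0 j.

Lemma weightD x y : weight (x + y) = weight x + weight y.
Proof. by rewrite /weight -big_split; apply: eq_bigr => j _; rewrite mxE. Qed.

Lemma weightN x : weight (- x) = - weight x.
Proof. by rewrite /weight -sumrN; apply: eq_bigr => j _; rewrite mxE. Qed.

Lemma weightB x y : weight (x - y) = weight x - weight y.
Proof. by rewrite weightD weightN. Qed.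

Lemma weight0 : weight 0 = 0.
Proof. by rewrite /weight big1 // => j _; rewrite mxE. Qed.

Lemma weightMn x k : weight (x *+ k) = weight x * k%:Z.
Proof.
by elim: k => [|k IH]; rewrite ?mulr0n ?weight0 ?mulr0 // mulrS weightD IH; lia.
Qed.

Lemma weight_natZ_ge0 (v : 'rV[nat]_m) : 0 <= weight (natZ v).
Proof. by apply: sumr_ge0 => j _; rewrite mxE. Qed.

Lemma weight_natZ_gt0 (v : 'rV[nat]_m) : v != 0 -> 0 < weight (natZ v).
Proof.
move=> v0; rewrite lt0r weight_natZ_ge0 andbT; apply: contra v0.
rewrite psumr_eq0; last by move=> j _; rewrite mxE.
move=> /allP H; apply/eqP/matrixP => i j; rewrite ord1 mxE.
by have := H j (mem_index_enum _); rewrite mxE => /eqP[].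
Qed.

Lemma weight_semigroup_ge0 x : semigroup a x -> 0 <= weight x.
Proof. by move=> [al ->]; apply: weight_natZ_ge0. Qed.

Lemma weight_semigroup_gt0 x : semigroup a x -> x != 0 -> 0 < weight x.
Proof. by move=> [al ->]; rewrite natZ_eq0; apply: weight_natZ_gt0. Qed.

Hypothesis ha : forall i, a i != 0.

(** Every generator has weight at least 1, so stripping generators one at a time gives the bound;
    finiteness of fibers follows. *)
Lemma mdeg_le_weight al : (mdeg al)%:Z <= weight (natZ (sdeg a al)).
Proof.
have [k] := ubnP (mdeg al); elim: k al => // k IH al; rewrite ltnS => Hk.
have [->|/eqP al0] := eqVneq al 0%MM; first by rewrite mdeg0 weight_natZ_ge0.
have [i hi] : exists i, (U_(i) <= al)%MM.
  apply: contrapT => H; apply: al0; apply/mnmP => i; rewrite mnm0E; apply/eqP.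
  by apply: contrapT => /negP hi; apply: H; exists i; rewrite lep1mP.
move: Hk; rewrite -(submK hi) mdegD mdeg1 sdegD natZD weightD sdeg1 => Hk.
have := IH (al - U_(i))%MM; have := weight_natZ_gt0 (a i) (ha i); lia.
Qed.

Lemma finite_fiber x : finite_set [set al | natZ (sdeg a al) = x].
Proof.
pose N := `|weight x|%N.+1.
apply: (@sub_finite_set _ _ [set bmnm be | be in [set: 'X_{1..n < N}]]).
  move=> al /= hx; have := mdeg_le_weight al; rewrite hx => hal.
  have hN : (mdeg al < N)%N by rewrite /N; lia.
  by exists (BMultinom hN).
by apply: finite_image; apply: finite_finset.
Qed.

Definition count_fact (P : pred 'X_{1..n}) x : int :=
  #|` fset_set [set al | P al /\ natZ (sdeg a al) = x]|%:Z.

Lemma finite_fiberP (P : 'X_{1..n} -> Prop) x :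
  finite_set [set al | P al /\ natZ (sdeg a al) = x].
Proof. by apply: sub_finite_set (finite_fiber x) => al []. Qed.

(** Adding [u] maps the counted factorizations of [x - natZ (sdeg a u)] bijectively onto those of
    [x] divisible by [u]; the subtraction leaves the others. *)
Lemma diff_count_fact (P : pred 'X_{1..n}) u :
  (forall al, P (al + u)%MM = P al) ->
  diff (natZ (sdeg a u)) (count_fact P)
    = count_fact (fun al => P al && ~~ (u <= al)%MM).
Proof.
move=> Pu; apply/funext => x; rewrite /diff /count_fact.
set A := [set al | _]; set B := [set al | _]; set C := [set al | _].
have fB : finite_set B by apply: finite_fiberP.
have fC : finite_set C by apply: finite_fiberP.
have -> : A = C `|` [set (be + u)%MM | be in B].
  apply/seteqP; split => [al [Pal hx]|al].
    have [hu|hu] := boolP (u <= al)%MM; last by left; split=> //; apply/andP.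
    right; exists (al - u)%MM; last by rewrite submK.
    split; first by rewrite -Pu submK.
    by rewrite -hx -{2}(submK hu) sdegD natZD addrK.
  case=> [[/andP[Pal _] hx]|[be [Pbe hx] <-]]; split=> //; first by rewrite Pu.
  by rewrite sdegD natZD hx subrK.
rewrite fset_setU //; last exact: finite_image.
rewrite fset_set_image // cardfsU.
have -> : (fset_set C `&` [fset (be + u)%MM | be in fset_set B])%fset = fset0.
  apply/fsetP => al; rewrite !inE; apply/negP => /andP[].
  rewrite in_fset_set // inE => -[/andP[_ /negP hu] _] /imfsetP[be _ hal].
  by apply: hu; rewrite hal lem_addl.
rewrite cardfs0 subn0 card_imfset /=; last by move=> be ga /addIm.
by rewrite PoszD addrK.
Qed.

Definition disjoint_supp u v := [forall j, (u j == 0%N) || (v j == 0%N)].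

Lemma disjoint_supp_le u v al :
  disjoint_supp u v -> (v <= al + u)%MM = (v <= al)%MM.
Proof.
move=> /forallP d; apply/mnm_lepP/mnm_lepP => H j; have := H j; rewrite mnmDE.
  by case/orP: (d j) => /eqP ->; rewrite ?addn0.
by move=> /leq_trans; apply; rewrite leq_addr.
Qed.

Definition reduced (us : seq 'X_{1..n}) al := all (fun u => ~~ (u <= al)%MM) us.

(** Disjointness of supports makes being reduced for the tail insensitive to adding the head, so the
    one-step count iterates. *)
Lemma diffs_count_fact us : pairwise disjoint_supp us ->
  diffs [seq natZ (sdeg a u) | u <- us] (count_fact predT) = count_fact (reduced us).
Proof.
elim: us => [|u us IH] //= /andP[/allP uus us_d].
rewrite IH // diff_count_fact; last first.
  by move=> al; apply: eq_in_all => v vus; rewrite disjoint_supp_le // uus.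
by congr count_fact; apply/funext => al; rewrite /= andbC.
Qed.

(** The unit exponents have disjoint supports, and the only exponent divisible by none of them is 0,
    which has degree 0. *)
Lemma diffs_gens_count_fact x :
  diffs [seq natZ (a i) | i <- enum 'I_n] (count_fact predT) x = (x == 0)%:R.
Proof.
have -> : [seq natZ (a i) | i <- enum 'I_n] =
    [seq natZ (sdeg a u) | u <- [seq U_(i)%MM | i <- enum 'I_n]].
  by rewrite -map_comp; apply: eq_map => i /=; rewrite sdeg1.
rewrite diffs_count_fact; last first.
  rewrite pairwise_map.
  have := enum_uniq 'I_n; rewrite uniq_pairwise; apply: sub_pairwise => i j /= ij.
  apply/forallP => k; rewrite !mnm1E.
  by case: (eqVneq i k) ij => // ->; rewrite eq_sym => /negbTE ->; rewrite orbT.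
have red0 al : reduced [seq U_(i)%MM | i <- enum 'I_n] al = (al == 0%MM).
  rewrite /reduced all_map; apply/allP/eqP => [H|-> i _]; last first.
    by rewrite /= lep1mP mnm0E.
  apply/mnmP => i; have := H i (mem_enum _ _).
  by rewrite /= lep1mP negbK mnm0E => /eqP.
rewrite /count_fact; case: eqVneq => [->|x0].
  rewrite (_ : [set _ | _] = [set 0%MM]); first by rewrite fset_set1 cardfs1.
  apply/seteqP; split => [al [/=]|al /= ->]; first by rewrite red0 => /eqP.
  by rewrite red0 eqxx sdeg0 natZ0.
rewrite (_ : [set _ | _] = set0); first by rewrite fset_set0 cardfs0.
apply/seteqP; split => // al [/=]; rewrite red0 => /eqP -> hx.
by move: x0; rewrite -hx sdeg0 natZ0 eqxx.
Qed.

End Factorizations.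

Arguments weight {m} x.
Arguments count_fact {m n} a P x.
Arguments disjoint_supp {n} u v.
Arguments reduced {n} us al.

(** * Factorizations of the Betti element *)

Section ToricIdeal.
Variables (K : fieldType) (m n : nat) (a : 'I_n -> 'rV[nat]_m).

Lemma toric_mapX al :
  toric_map a ('X_[al] : {mpoly K[n]}) = laurent_mono K (natZ (sdeg a al)).
Proof.
(* The coefficient embedding is packaged as a ring morphism so that the evaluation lemmas for [mmap]
   apply. *)
pose f : {rmorphism K -> {fraction {mpoly K[m]}}} := (@tofrac _ \o @mpolyC m K)%FUN.
rewrite /toric_map (mmapX _ f) /mmap1 /laurent_mono.
under eq_bigr do rewrite -prodrXl.
rewrite exchange_big; apply: eq_bigr => j _ /=.
under eq_bigr => i _ do rewrite mxE -exprnP -exprM.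
by rewrite prodrXr mxE sdegE.
Qed.

Lemma toric_idealB al be : sdeg a al = sdeg a be ->
  toric_ideal a ('X_[al] - 'X_[be] : {mpoly K[n]}).
Proof.
pose f : {rmorphism K -> {fraction {mpoly K[m]}}} := (@tofrac _ \o @mpolyC m K)%FUN.
move=> h; rewrite /toric_ideal /=.
by rewrite /toric_map (mmapB _ f) -!/(toric_map _ _) !toric_mapX h subrr.
Qed.

(* A binomial of the toric ideal has each of its monomials divisible by a
   monomial of some generator, and all of the latter have degree [b]. *)
Lemma betti_divides b al be : unique_betti K a b ->
  sdeg a al = sdeg a be -> al != be ->
  exists2 de, (de <= al)%MM & sdeg a de = b.
Proof.
move=> [G [Gb eqG]] /toric_idealB; rewrite eqG => -[s [sG eqs]] ne.
have : ('X_[al] - 'X_[be] : {mpoly K[n]})@_al != 0.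
  by rewrite mcoeffB !mcoeffX eqxx (eq_sym be) (negbTE ne) subr0 oner_eq0.
rewrite eqs raddf_sum /= => /negP H.
have [c cs hc] : exists2 c, c \in s & al \in msupp (c.1 * c.2).
  apply: contrapT => Hn; apply: H; rewrite big_seq big1 // => c cs.
  by apply/eqP; rewrite mcoeff_eq0; apply/negP => hc; apply: Hn; exists c.
have /allpairsP[[m1 m2] /= [_ h2 ->]] := msuppM_le hc.
by exists m2; [rewrite lem_addl | apply: Gb (sG _ cs) _ h2].
Qed.

End ToricIdeal.

(** * Normal forms of factorizations and the rank of the relation lattice *)

Section BettiFactorizations.
Variables (m n : nat) (a : 'I_n -> 'rV[nat]_m) (b : 'rV[nat]_m).
Hypothesis ha : forall i, a i != 0.
Hypothesis div_b : forall al be, sdeg a al = sdeg a be -> al != be ->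
  exists2 de, (de <= al)%MM & sdeg a de = b.

Lemma factorizations_disjoint u v :
  sdeg a u = b -> sdeg a v = b -> u != v -> disjoint_supp u v.
Proof.
move=> hu hv ne; apply: contraT; rewrite negb_forall => /existsP[j].
rewrite negb_or -!lep1mP => /andP[ju jv].
have [||de hde de_b] := div_b (u - U_(j))%MM (v - U_(j))%MM.
- by apply: (sdegIr _ _ _ U_(j)%MM); rewrite !submK // hu hv.
- by apply: contra ne => /eqP h; rewrite -(submK ju) h submK.
(* After cancelling generator [j], the rest of [u] still contains a factorization of [b]; comparing
   weights contradicts positivity of the weight of [a j]. *)
have := congr1 (fun w => weight (natZ w)) hu.
rewrite -(submK ju) -(submK hde) !sdegD !natZD !weightD de_b sdeg1.
have := weight_natZ_gt0 _ (a j) (ha j).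
have := weight_natZ_ge0 _ (sdeg a (u - U_(j) - de)%MM); lia.
Qed.

(* [u0] is one factorization of [b], and [us] lists all the others. *)
Variables (u0 : 'X_{1..n}) (us : seq 'X_{1..n}).
Hypothesis us_uniq : uniq us.
Hypothesis us_b : forall u, u \in us -> [/\ sdeg a u = b, sdeg a u0 = b & u != u0].
Hypothesis us_all : forall u, sdeg a u = b -> u = u0 \/ u \in us.

Lemma factorizations_pairwise : pairwise disjoint_supp us.
Proof.
apply: (@sub_in_pairwise _ (mem us) [rel u v | u != v]); first 1 last.
- exact/allP.
- by rewrite -uniq_pairwise.
move=> u v /us_b[hu _ _] /us_b[hv _ _]; exact: factorizations_disjoint.
Qed.

Definition ratv (al : 'X_{1..n}) : 'rV[rat]_n := \row_j (al j)%:R.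

Lemma ratvD al be : ratv (al + be)%MM = ratv al + ratv be.
Proof. by apply/matrixP => i j; rewrite !mxE mnmDE natrD. Qed.

Hypothesis hb : b != 0.

Lemma mdeg_factorization u : sdeg a u = b -> (0 < mdeg u)%N.
Proof.
move=> hu; rewrite lt0n mdeg_eq0; apply: contra hb => /eqP u_0.
by rewrite -hu u_0 sdeg0.
Qed.

Definition moves := [seq ratv u - ratv u0 | u <- us].

(** Trading a divisor [u] in [us] for [u0] keeps the degree and changes the exponent by a move.
    Since [u0] may be longer than [u], the induction runs on [al - u]; adding [u0] afterwards keeps
    the result reduced because its support is disjoint from the others. *)
Lemma reduced_exists al : exists nu,
  [/\ reduced us nu, sdeg a nu = sdeg a al & ratv al - ratv nu \in <<moves>>%VS].
Proof.
have [k] := ubnP (mdeg al); elim: k al => // k IH al; rewrite ltnS => Hk.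
have [r|/allPn[u u_us]] := boolP (reduced us al).
  by exists al; rewrite subrr mem0v.
rewrite negbK => hu; have [ub u0b ne] := us_b u u_us.
have := mdeg_factorization u ub; move: Hk.
rewrite -{1}(submK hu) mdegD => Hk u_gt0.
have [|nu [nu_r nu_d nu_s]] := IH (al - u)%MM.
  by apply: leq_trans Hk; rewrite -addn1 leq_add2l.
exists (nu + u0)%MM; split.
- apply/allP => v v_us; have [vb _ v0] := us_b v v_us.
  rewrite disjoint_supp_le; first exact: (allP nu_r).
  by apply: factorizations_disjoint => //; rewrite eq_sym.
- by rewrite -(submK hu) !sdegD nu_d u0b ub.
have -> : ratv al - ratv (nu + u0)%MM
    = (ratv (al - u)%MM - ratv nu) + (ratv u - ratv u0).
  by rewrite -{1}(submK hu) !ratvD opprD addrACA.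
by rewrite memvD // memv_span //; apply/mapP; exists u.
Qed.

(** Two distinct reduced factorizations of one element are each divisible by a factorization of [b],
    which can only be [u0]; cancelling it gives a descent. *)
Lemma reduced_unique al be : reduced us al -> reduced us be ->
  sdeg a al = sdeg a be -> al = be.
Proof.
have [k] := ubnP (mdeg al); elim: k al be => // k IH al be; rewrite ltnS => Hk.
move=> ra rb hd; apply/eqP; apply: contraT => ne.
have red_u0 ga de : reduced us ga -> (de <= ga)%MM -> sdeg a de = b -> de = u0.
  move=> rga dega /us_all[//|de_us].
  by have := allP rga _ de_us; rewrite dega.
have [de hde de_b] := div_b _ _ hd ne.
have [de' hde' de'_b] : exists2 de, (de <= be)%MM & sdeg a de = b.
  by apply: div_b (esym hd) _; rewrite eq_sym.
have ? := red_u0 _ _ ra hde de_b; have ? := red_u0 _ _ rb hde' de'_b; subst de de'.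
have := mdeg_factorization _ de_b; move: Hk; rewrite -{1}(submK hde) mdegD => Hk u_gt0.
have red_sub ga : reduced us ga -> reduced us (ga - u0)%MM.
  move=> /allP rga; apply/allP => u /rga; apply: contra => /lepm_trans; apply.
  exact: lem_subr.
suff h : (al - u0 = be - u0)%MM by rewrite -(submK hde) h submK ?eqxx in ne.
apply: IH; [|exact: red_sub|exact: red_sub|].
  by apply: leq_trans Hk; rewrite -addn1 leq_add2l.
by apply: (sdegIr _ _ _ u0); rewrite !submK.
Qed.

(** A coordinate [j] in the support of the first [u] vanishes on [u0] and on all later
    factorizations, so the first move is outside the span of the rest. *)
Lemma free_moves : free moves.
Proof.
have : pairwise disjoint_supp us by exact: factorizations_pairwise.
have : {in us, forall u, disjoint_supp u u0 /\ (0 < mdeg u)%N}.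
  move=> u /us_b[hu hu0 ne]; split; first exact: factorizations_disjoint.
  exact: mdeg_factorization.
rewrite /moves; elim: us => [|u vs IH] /=; first by rewrite nil_free.
move=> H /andP[/allP u_vs vs_d]; rewrite free_cons IH ?andbT //; last first.
  by move=> v v_vs; apply: H; rewrite inE v_vs orbT.
have [u_u0 u_gt0] := H u (mem_head _ _).
have [j uj] : exists j, u j != 0%N.
  apply: contrapT => Hn; move: u_gt0; rewrite mdegE big1 // => j _.
  by apply/eqP; apply: contrapT => /negP uj; apply: Hn; exists j.
pose f : 'Hom('rV[rat]_n, 'M[rat]_(1, 1)) := linfun (mulmxr (delta_mx j 0)).
have fE w : (w \in lker f) = (w 0 j == 0).
  rewrite memv_ker lfunE /= -colE; apply/eqP/eqP => [/matrixP/(_ 0 0)|h].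
    by rewrite !mxE.
  by apply/matrixP => i k; rewrite !mxE !ord1.
have f_u0 v : disjoint_supp u v -> v j = 0%N.
  by move=> /forallP /(_ j); rewrite (negbTE uj) => /eqP.
apply/negP => Hin.
have sub : (<<[seq ratv v - ratv u0 | v <- vs]>> <= lker f)%VS.
  apply/span_subvP => _ /mapP[v v_vs ->]; rewrite fE !mxE.
  by rewrite (f_u0 v (u_vs _ v_vs)) (f_u0 u0 u_u0) subrr.
have := subvP sub _ Hin; rewrite fE !mxE (f_u0 u0) // subr0.
by rewrite pnatr_eq0 (negbTE uj).
Qed.

(** Rank-nullity for the map $\mathbb{Q}^n\to\mathbb{Q}^m$ sending the basis vectors to the
    generators: the kernel is spanned by the moves. *)
Lemma rank_semi_eq : (size us + rank_semi a)%N = n.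
Proof.
pose M : 'M[rat]_(n, m) := \matrix_i natQ (a i).
pose f : 'Hom('rV[rat]_n, 'rV[rat]_m) := linfun (mulmxr M).
have f_ratv al : f (ratv al) = natQ (sdeg a al).
  rewrite lfunE /=; apply/matrixP => i j; rewrite !mxE sdegE natr_sum.
  by apply: eq_bigr => k _; rewrite !mxE !ord1 natrM mulrC.
have f_img : limg f = <<[seq natQ (a i) | i <- enum 'I_n]>>%VS.
  have -> : fullv = <<[seq delta_mx ord0 i | i <- enum 'I_n]>>%VS :> {vspace 'rV[rat]_n}.
    apply/esym/eqP; rewrite eqEsubv subvf; apply/subvP => v _; rewrite (row_sum_delta v).
    apply: memv_suml => i _; rewrite memvZ // memv_span //.
    by apply/mapP; exists i; rewrite ?mem_enum.
  rewrite limg_span -map_comp; congr <<_>>%VS; apply: eq_map => i /=.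
  by rewrite lfunE /= -rowE rowK.
have f_ker : lker f = <<moves>>%VS.
  apply/eqP; rewrite eqEsubv; apply/andP; split; last first.
    apply/span_subvP => _ /mapP[u /us_b[hu hu0 _] ->].
    by rewrite memv_ker linearB /= !f_ratv hu hu0 subrr.
  apply/subvP => v; rewrite memv_ker => /eqP fv.
  (* Clearing denominators: [z] lists the coordinates of $Dv$, and [al], [be] are its positive and
     negative parts. [Negz k] is $-(k+1)$, hence [k.+1]. *)
  pose D := \prod_j denq (v 0 j).
  have D0 : D%:~R != 0 :> rat.
    by rewrite intr_eq0; apply/prodf_neq0 => j _; apply: denq_neq0.
  pose z j : int := numq (v 0 j) * \prod_(k | k != j) denq (v 0 k).
  pose al := [multinom (if z j is Posz k then k else 0%N) | j < n].
  pose be := [multinom (if z j is Negz k then k.+1 else 0%N) | j < n].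
  have Dv : D%:~R *: v = ratv al - ratv be.
    apply/matrixP => i j; rewrite ord1 !mxE.
    have -> : D%:~R * v 0 j = (z j)%:~R.
      rewrite /D (bigD1 j) //= rmorphM /= -{2}(divq_num_den (v 0 j)) /z rmorphM /=.
      by field; rewrite intr_eq0 denq_neq0.
    by rewrite !mnmE; case: (z j) => k /=; rewrite ?subr0 ?sub0r // NegzE rmorphN.
  have hd : sdeg a al = sdeg a be.
    have : f (ratv al - ratv be) = 0 by rewrite -Dv linearZ /= fv scaler0.
    rewrite linearB /= !f_ratv => /eqP; rewrite subr_eq0 => /eqP /matrixP h.
    apply/matrixP => i j; have := h i j; rewrite !mxE => /eqP.
    by rewrite eqr_nat => /eqP.
  (* Both parts have the same degree, hence the same normal form, and their difference is a
     combination of moves. *)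
  have [nu [nu_r nu_d nu_s]] := reduced_exists al.
  have [nu' [nu'_r nu'_d nu'_s]] := reduced_exists be.
  have ? : nu = nu' by apply: reduced_unique => //; rewrite nu_d nu'_d.
  subst nu'; rewrite -[v](scalerK D0) Dv memvZ //.
  by rewrite -(subrKA (ratv nu)) -[ratv nu - ratv be]opprB memvB.
have := limg_ker_dim f fullv; rewrite capfv f_ker f_img /rank_semi => h.
move: free_moves; rewrite /free => /eqP h'; move: h; rewrite h' size_map.
by rewrite dimvf /dim /= mul1n.
Qed.

End BettiFactorizations.

(** * The Moebius function as a convolution inverse *)

Section Mobius.
Variables (m n : nat) (a : 'I_n -> 'rV[nat]_m).
Implicit Types (x y : 'rV[int]_m).
Hypothesis ha : forall i, a i != 0.

Lemma lt_semiP x y :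
  reflect (semigroup a (y - x) /\ x <> y) (lt_semi a x y).
Proof. exact: asboolP. Qed.

Lemma lt_semi_weight x y : lt_semi a x y -> weight x + 1 <= weight y.
Proof.
case/lt_semiP => Sxy /eqP xy.
have := weight_semigroup_gt0 _ _ _ _ Sxy; rewrite weightB subr_eq0 eq_sym => /(_ xy).
by lia.
Qed.

Lemma path_semigroup x z : path (lt_semi a) x z -> semigroup a (last x z - x).
Proof.
elim: z x => [|y z IH] x /=; first by rewrite subrr => _; apply: semigroup0.
move=> /andP[/lt_semiP[xy _] /IH yz]; rewrite -(subrKA y).
exact: semigroupD.
Qed.

Lemma path_weight x z :
  path (lt_semi a) x z -> weight x + (size z)%:Z <= weight (last x z).
Proof.
elim: z x => [|y z IH] x /=; first by rewrite addr0.
by move=> /andP[/lt_semi_weight xy /IH]; lia.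
Qed.

(** Supplies finite lists over which convolutions on the semigroup can be summed. *)
Lemma initial_segment (N : nat) : exists s : seq 'rV[int]_m,
  uniq s /\ forall y, y \in s <-> semigroup a y /\ weight y <= N%:Z.
Proof.
pose A := [set y | semigroup a y /\ weight y <= N%:Z].
have fA : finite_set A.
  apply: (@sub_finite_set _ _
    [set natZ (sdeg a (bmnm be)) | be in [set: 'X_{1..n < N.+1}]]).
    move=> y [[al ->] hal]; have := mdeg_le_weight _ _ a ha al => hN.
    have hN' : (mdeg al < N.+1)%N by lia.
    by exists (BMultinom hN').
  by apply: finite_image; apply: finite_finset.
exists (fset_set A); split=> [|y]; first exact: fset_uniq.
by rewrite in_fset_set // inE.
Qed.

Lemma card_fiberwise (T U : choiceType) (g : T -> U) (F : {fset T}) (s : seq U) :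
  uniq s -> (forall t, t \in F -> g t \in s) ->
  #|` F| = (\sum_(y <- s) #|` [fset t in F | g t == y]%fset|)%N.
Proof.
move=> us Fs; rewrite card_fset_sum1.
under [RHS]eq_bigr => y _ do rewrite card_fset_sum1 -big_fset_condE /=.
rewrite (exchange_big_dep xpredT) //= big_seq [RHS]big_seq.
apply: eq_bigr => t tF; rewrite sum1_count.
by rewrite (@eq_count _ _ (pred1 (g t))) ?count_uniq_mem ?Fs // => y /=; rewrite eq_sym.
Qed.

Definition nchains l x : nat := #|` fset_set (@chains m n a l 0 x)|.

Definition chains_below l x : set (l.-tuple 'rV[int]_m) :=
  [set z | path (lt_semi a) 0 z /\ lt_semi a (last 0 z) x].

Lemma chains_rcons l x :
  @chains m n a l.+1 0 x = [set rcons_tuple z x | z in chains_below l x].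
Proof.
apply/seteqP; split => [z [hz zx]|_ [z [hz zx] <-]]; last first.
  by split; rewrite /= ?rcons_path ?last_rcons // hz.
case/tupleP: z => y z in hz zx *.
pose z' := [tuple of belast y z].
have zE : [tuple of y :: z] = rcons_tuple z' x.
  by apply: val_inj; rewrite /= -zx /= -lastI.
exists z'; last by [].
by move: hz; rewrite zE /= rcons_path => /andP.
Qed.

Lemma chains_below_mem (N : nat) (s : seq _) l x z :
  (forall y, y \in s <-> semigroup a y /\ weight y <= N%:Z) ->
  weight x <= N%:Z -> chains_below l x z -> last 0 z \in s.
Proof.
move=> hs hx [hz zx]; apply/hs; split.
  by rewrite -[last 0 z]subr0; apply: path_semigroup.
by have := lt_semi_weight _ _ zx; lia.
Qed.

Lemma finite_chains_below l x :
  (forall y, finite_set (@chains m n a l 0 y)) -> finite_set (chains_below l x).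
Proof.
move=> fC; have [s [us hs]] := initial_segment `|weight x|%N.
apply: (@sub_finite_set _ _ (\bigcup_(y in [set y | y \in s]) @chains m n a l 0 y)).
  move=> z hz; exists (last 0 z) => /=; last by case: hz.
  by apply: chains_below_mem hs _ hz; lia.
by apply: bigcup_finite => // y _; apply: fC.
Qed.

Lemma finite_chains l x : finite_set (@chains m n a l 0 x).
Proof.
elim: l x => [|l IH] x.
  apply: (@sub_finite_set _ _ [set [tuple]]); last exact: finite_set1.
  by move=> z _; rewrite /= [z]tuple0.
by rewrite chains_rcons; apply/finite_image/finite_chains_below.
Qed.

(** Chains are sorted by their penultimate element, which lies in [s] because its weight is below
    that of [x]. *)
Lemma nchains_recr (N : nat) (s : seq _) l x : uniq s ->
  (forall y, y \in s <-> semigroup a y /\ weight y <= N%:Z) ->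
  weight x <= N%:Z ->
  nchains l.+1 x = (\sum_(y <- s | lt_semi a y x) nchains l y)%N.
Proof.
move=> us hs hx; rewrite /nchains chains_rcons.
have fA : finite_set (chains_below l x).
  by apply: finite_chains_below => y; apply: finite_chains.
rewrite fset_set_image // card_imfset /=; last first.
  by move=> z z' /(congr1 val) /= /rcons_inj[/val_inj].
rewrite (card_fiberwise _ _ (fun z : l.-tuple 'rV[int]_m => last 0 z) _ s us); last first.
  by move=> z; rewrite in_fset_set // inE; apply: chains_below_mem hs hx.
rewrite [RHS]big_mkcond; apply: eq_bigr => y _; case: ifPn => yx.
  congr #|` _|; apply/fsetP => z; rewrite !inE.
  rewrite (in_fset_set fA) (in_fset_set (finite_chains l y)).
  apply/idP/idP => [/andP[]|]; rewrite !inE; first by move=> [hz _] /eqP.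
  by move=> [hz zy]; apply/andP; split; [rewrite inE; split; rewrite ?zy|apply/eqP].
apply/eqP; rewrite cardfs_eq0; apply/eqP/fsetP => z; rewrite !inE (in_fset_set fA).
apply/negP => /andP[]; rewrite inE => -[_ zx] /eqP zy.
by rewrite zy (negbTE yx) in zx.
Qed.

Lemma nchains0 x : nchains 0 x = (x == 0).
Proof.
rewrite /nchains; case: eqVneq => [->|x0].
  rewrite (_ : @chains _ _ _ _ _ _ = [set [tuple]]) ?fset_set1 ?cardfs1 //.
  by apply/seteqP; split => z; rewrite /= [z]tuple0.
rewrite (_ : @chains _ _ _ _ _ _ = set0) ?fset_set0 ?cardfs0 //.
apply/seteqP; split => // z; rewrite /= [z]tuple0 => -[_] /= h.
by rewrite h eqxx in x0.
Qed.

Lemma nchains_eq0 l x : weight x < l%:Z \/ ~ semigroup a x -> nchains l x = 0%N.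
Proof.
move=> hx; rewrite /nchains (_ : @chains _ _ _ _ _ _ = set0) ?fset_set0 ?cardfs0 //.
apply/seteqP; split => // z [hz zx]; case: hx => hx.
  have := path_weight _ _ hz; rewrite zx weight0 size_tuple; lia.
by apply: hx; have := path_semigroup _ _ hz; rewrite zx subr0.
Qed.

(** Each step raises the weight by at least 1, so longer chains do not exist. Leaving [L] free
    allows one common range of lengths for all elements of a list. *)
Lemma mobiusE L x : weight x < L%:Z ->
  mobius a x = \sum_(l < L) (-1) ^+ l * (nchains l x)%:Z.
Proof.
move=> hx; rewrite (fsbig_ord _ _ (fun l => (-1) ^+ l * (nchains l x)%:Z)).
apply/esym/fsbig_widen => // l [_ /= /negP]; rewrite -leqNgt => hl.
by rewrite /= nchains_eq0 ?mulr0 //; left; lia.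
Qed.

Lemma mobius_eq0 x : ~ semigroup a x -> mobius a x = 0.
Proof.
move=> hx; rewrite (mobiusE `|weight x|.+1); last lia.
by rewrite big1 // => l _; rewrite nchains_eq0 ?mulr0 //; right.
Qed.

(* Splitting off the last step of a chain makes the alternating sum telescope. *)
Lemma mobius_conv (N : nat) (s : seq _) x : uniq s ->
  (forall y, y \in s <-> semigroup a y /\ weight y <= N%:Z) ->
  weight x <= N%:Z ->
  \sum_(y <- s) mobius a y * `[< semigroup a (x - y) >]%:R = (x == 0)%:R.
Proof.
move=> us hs hx.
have -> : \sum_(y <- s) mobius a y * `[< semigroup a (x - y) >]%:R =
    \sum_(y <- s | lt_semi a y x) mobius a y + mobius a x.
  have -> : mobius a x = \sum_(y <- s | y == x) mobius a y.
    have [xs|xs] := boolP (x \in s).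
      by rewrite -big_filter filter_pred1_uniq // big_seq1.
    rewrite mobius_eq0 => [|Sx]; last by move/negP: xs; apply; apply/hs.
    rewrite big_seq_cond big1 // => y /andP[ys /eqP yx].
    by rewrite -yx ys in xs.
  rewrite [X in _ = X + _]big_mkcond [X in _ = _ + X]big_mkcond -big_split /=.
  apply: eq_bigr => y _; case: eqVneq => [->|yx].
    rewrite subrr asboolT ?mulr1; last exact: semigroup0.
    by case: ifPn => [/lt_semiP[_]//|_]; rewrite add0r.
  have -> : `[< semigroup a (x - y) >] = lt_semi a y x.
    by apply/asboolP/lt_semiP => [?|[]//]; split=> //; apply/eqP.
  by case: (lt_semi a y x); rewrite ?mulr1 ?mulr0 addr0.
have -> : \sum_(y <- s | lt_semi a y x) mobius a y =
    \sum_(l < N.+1) (-1) ^+ l * (nchains l.+1 x)%:Z.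
  rewrite big_seq_cond.
  rewrite (eq_bigr (fun y => \sum_(l < N.+1) (-1) ^+ l * (nchains l y)%:Z)).
    rewrite -big_seq_cond exchange_big; apply: eq_bigr => l _ /=.
    by rewrite (nchains_recr N s) // -mulr_sumr (big_morph Posz PoszD (erefl _)).
  by move=> y /andP[/hs[_ hy] _]; apply: mobiusE; lia.
rewrite (mobiusE N.+1); last lia.
have tele L : \sum_(l < L) (-1) ^+ l * (nchains l.+1 x)%:Z +
    \sum_(l < L) (-1) ^+ l * (nchains l x)%:Z =
    (nchains 0 x)%:Z - (-1) ^+ L * (nchains L x)%:Z.
  elim: L => [|L IH]; first by rewrite !big_ord0 expr0 mul1r !subrr.
  by rewrite !big_ord_recr /= addrACA IH exprS; ring.
(* The boundary term at [N.+1] vanishes since chains ending at [x] have length at most [N]. *)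
rewrite tele nchains0 nchains_eq0 ?mulr0 ?subr0 //; last by left; lia.
by case: (x == 0).
Qed.

End Mobius.

(** * Inverting the difference operators *)

Section Uniqueness.
Variable m : nat.
Implicit Types (f g : 'rV[int]_m -> int) (x v : 'rV[int]_m).

(** The differences look only downward in weight, so a function may be replaced by a truncated
    convolution agreeing with it up to weight [N]. *)
Lemma eq_diffs_below (N : int) vs f g :
  (forall v, v \in vs -> 0 <= weight v) ->
  (forall x, weight x <= N -> f x = g x) ->
  forall x, weight x <= N -> diffs vs f x = diffs vs g x.
Proof.
move=> vs0 fg; elim: vs vs0 => //= v vs IH vs0 x hx.
have v0 := vs0 v (mem_head _ _).
have {}IH := IH (fun w w_vs => vs0 w (mem_behead (s := v :: vs) w_vs)).
by rewrite /diff !IH // weightB; lia.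
Qed.

(** The value at [x] is recovered from the difference and the value at [x - v]; the recursion stops
    at negative weight. *)
Lemma diff_inj v f g : 0 < weight v ->
  (forall x, weight x < 0 -> f x = g x) ->
  diff v f = diff v g -> f = g.
Proof.
move=> v0 fg dfg; apply/funext => x.
have [k] := ubnP `|weight x|%N; elim: k x => // k IH x hk.
have [hx|hx] := ltrP (weight x) 0; first exact: fg.
have [hxv|hxv] := ltrP (weight (x - v)) 0.
  have := congr1 (fun h => h x) dfg; rewrite /diff (fg _ hxv).
  exact: addIr.
have := congr1 (fun h => h x) dfg; rewrite /diff (IH (x - v)); first exact: addIr.
by rewrite weightB in hxv *; lia.
Qed.

Lemma diffs_nseq_inj r v f g : 0 < weight v ->
  (forall x, weight x < 0 -> f x = g x) ->
  diffs (nseq r v) f = diffs (nseq r v) g -> f = g.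
Proof.
move=> v0 fg; elim: r => //= r IH /diff_inj h; apply/IH/h => // x hx.
apply: (eq_diffs_below (-1)); last by lia.
  by move=> w; rewrite mem_nseq => /andP[_ /eqP ->]; lia.
by move=> y hy; apply: fg; lia.
Qed.

End Uniqueness.

(** * Negative binomial coefficients along the multiples of the Betti element *)

Section NegativeBinomial.
Variables (m : nat) (b : 'rV[nat]_m).
Hypothesis hb : b != 0.
Implicit Types x : 'rV[int]_m.

Let b_gt0 : 0 < weight (natZ b) := weight_natZ_gt0 m b hb.

Lemma natZ_mulrn_inj : injective (fun k => natZ b *+ k).
Proof. by move=> k l /(congr1 weight); rewrite !weightMn; nia. Qed.

Definition multiple x := exists k, x = natZ b *+ k.

(** Chosen with the same default as [kcoef], so that the two unfold to the same term in the final
    comparison. *)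
Definition multiplier x : nat := xget 0%N [set k | x = natZ b *+ k].

Lemma multiplierE k : multiplier (natZ b *+ k) = k.
Proof.
by rewrite /multiplier; apply: xget_unique => // l /= /natZ_mulrn_inj.
Qed.

(* The coefficients of [(1 - t^b)^(-r)]; for [r = 0] truncated subtraction makes
   the binomial coefficient [1] at [k = 0] and [0] elsewhere. *)
Definition neg_binomial (r : nat) x : int :=
  if `[< multiple x >] then 'C(multiplier x + r - 1, multiplier x)%:Z else 0.

Lemma neg_binomialE r k : neg_binomial r (natZ b *+ k) = 'C(k + r - 1, k)%:Z.
Proof. by rewrite /neg_binomial asboolT ?multiplierE //; exists k. Qed.

Lemma neg_binomial_out r x : ~ multiple x -> neg_binomial r x = 0.
Proof. by move=> hx; rewrite /neg_binomial asboolF. Qed.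

Lemma neg_binomial0 : neg_binomial 0 = (fun x => (x == 0)%:R).
Proof.
apply/funext => x; have [[k ->]|hx] := pselect (multiple x); last first.
  rewrite neg_binomial_out //; case: eqVneq => // x0.
  by case: hx; exists 0%N; rewrite mulr0n.
rewrite neg_binomialE -[0 in RHS](mulr0n (natZ b)) (inj_eq natZ_mulrn_inj).
by case: k => [|k] //; rewrite bin_small // addn0 subn1.
Qed.

(** Pascal's rule for positive multiples; at 0 the shifted argument has negative weight and
    contributes nothing. *)
Lemma diff_neg_binomial r : diff (natZ b) (neg_binomial r.+1) = neg_binomial r.
Proof.
apply/funext => x; rewrite /diff.
have [[[|k] ->]|hx] := pselect (multiple x).
- rewrite !neg_binomialE !bin0 neg_binomial_out ?subr0 // => -[k].
  move=> /(congr1 weight); rewrite weightB !weightMn; nia.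
- rewrite {2}mulrSr addrK !neg_binomialE !addSn !addnS !subn1 /= binS PoszD.
  by rewrite addrK.
rewrite !neg_binomial_out ?subr0 // => -[k hk].
by apply: hx; exists k.+1; rewrite mulrSr -hk subrK.
Qed.

Lemma diffs_neg_binomial r :
  diffs (nseq r (natZ b)) (neg_binomial r) = (fun x => (x == 0)%:R).
Proof.
elim: r => [|r IH] /=; first exact: neg_binomial0.
by rewrite diffsC diff_neg_binomial.
Qed.

End NegativeBinomial.

(** * The difference equation for the Moebius function and the conclusion *)

Lemma unique_betti_factorizations (m n : nat) (a : 'I_n -> 'rV[nat]_m)
    (b : 'rV[nat]_m) : (forall i, a i != 0) ->
  exists u0 us, [/\ uniq us,
    forall u, u \in us -> [/\ sdeg a u = b, sdeg a u0 = b & u != u0] &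
    forall u, sdeg a u = b -> u = u0 \/ u \in us].
Proof.
move=> ha; pose s : seq 'X_{1..n} := fset_set [set al | natZ (sdeg a al) = natZ b].
have us : uniq s by apply: fset_uniq.
have hs u : u \in s <-> sdeg a u = b.
  rewrite /s in_fset_set; last exact: finite_fiber.
  by rewrite inE; split=> [/natZ_inj|/= ->].
case: s us hs => [_ hs|u0 us /= /andP[u0us us_uniq] hs].
  (* If [b] has no factorization, 0 is only a placeholder for [u0]: nothing is claimed of it, as the
     list is empty. *)
  by exists 0%MM, [::]; split=> // u /hs.
exists u0, us; split=> // u.
  move=> u_us; split; [|exact/hs/mem_head|by apply: contraNneq u0us => <-].
  by apply/hs; rewrite inE u_us orbT.
by move=> /hs; rewrite inE => /orP[/eqP|]; [left|right].
Qed.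

Lemma count_reduced (m n : nat) (a : 'I_n -> 'rV[nat]_m) (us : seq 'X_{1..n}) x :
  (forall al, exists2 nu, reduced us nu & sdeg a nu = sdeg a al) ->
  (forall al be, reduced us al -> reduced us be ->
     sdeg a al = sdeg a be -> al = be) ->
  count_fact a (reduced us) x = `[< semigroup a x >]%:R.
Proof.
move=> ex un; rewrite /count_fact; case: asboolP => [[al ->]|nS].
  have [nu nu_r nu_d] := ex al.
  rewrite (_ : [set _ | _] = [set nu]) ?fset_set1 ?cardfs1 //.
  apply/seteqP; split => [be [be_r /natZ_inj h]|_ ->] /=; last by rewrite nu_d.
  by apply: un; rewrite // h nu_d.
rewrite (_ : [set _ | _] = set0) ?fset_set0 ?cardfs0 //.
by apply/seteqP; split => // al [_ h]; apply: nS; exists al.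
Qed.

(** With $\delta$ the delta function and $\chi$ the indicator of the semigroup, $\mu=\mu*\delta$ and
    $\mu*\chi=\delta$. Commuting the operators on [G] gives $D_{vs}\delta=D_{vs}D_{ws}G=D_{ws}\chi$,
    and convolution with $\mu$ gives the claim. *)
Lemma diffs_mobius (m n : nat) (a : 'I_n -> 'rV[nat]_m) (vs ws : seq 'rV[int]_m)
    (G : 'rV[int]_m -> int) :
  (forall i, a i != 0) ->
  (forall v, v \in vs -> 0 <= weight v) ->
  (forall v, v \in ws -> 0 <= weight v) ->
  diffs ws G = (fun x => (x == 0)%:R) ->
  diffs vs G = (fun x => `[< semigroup a x >]%:R) ->
  diffs vs (mobius a) = diffs ws (fun x => (x == 0)%:R).
Proof.
move=> ha vs0 ws0 hws hvs; apply/funext => x.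
pose N := `|weight x|%N.
have [s [us hs]] := initial_segment m n a ha N.
pose conv (h : 'rV[int]_m -> int) y := \sum_(z <- s) mobius a z * h (y - z).
have hx : weight x <= N%:Z by rewrite /N; lia.
transitivity (diffs vs (conv (fun x => (x == 0)%:R)) x).
  apply: (eq_diffs_below m N%:Z) => // y hy; rewrite /conv.
  have [ys|ys] := boolP (y \in s).
    rewrite (bigD1_seq y) //= subrr eqxx mulr1 big1 ?addr0 // => z zy.
    by rewrite subr_eq0 eq_sym (negbTE zy) mulr0.
  rewrite mobius_eq0 ?big_seq ?big1 // => [z zs|Sy].
    rewrite subr_eq0; case: eqP => [yz|_]; last by rewrite mulr0.
    by rewrite yz zs in ys.
  by move/negP: ys; apply; apply/hs.
transitivity (diffs ws (conv (fun x => `[< semigroup a x >]%:R)) x).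
  have convE ts f : diffs ts (conv f) x = conv (diffs ts f) x.
    exact: (diffs_sum _ _ s xpredT (mobius a) id).
  by rewrite !convE -hws -hvs diffs_catC.
apply: (eq_diffs_below m N%:Z) => // y hy.
exact: (mobius_conv m n a ha N).
Qed.

(* d <= n always; for n = d truncated subtraction gives 'C(k - 1, k), which is 1
   for k = 0 and 0 for k >= 1, as required by the convention. *)
Theorem theorem4p1 (K : fieldType) (m n d : nat) (a : 'I_n -> 'rV[nat]_m)
    (b : 'rV[nat]_m)
    (ha : forall i, a i != 0) (hb : b != 0) (hbetti : unique_betti K a b)
    (hd : d = rank_semi a) (x : 'rV[int]_m) :
  mobius a x =
    \sum_(A : {set 'I_n} | `[< exists k : nat, betti_multiple a b x A k >])
      (-1) ^+ #|A| *
      ('C(kcoef a b x A + n - d - 1, kcoef a b x A))%:Z.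
Proof.
have div_b al be := betti_divides K m n a b al be hbetti.
have [u0 [us [us_uniq us_b us_all]]] := unique_betti_factorizations m n a b ha.
pose r := size us; pose v := natZ b.
have v_gt0 : 0 < weight v by apply: weight_natZ_gt0.
have hn : n = (r + d)%N.
  by rewrite hd (rank_semi_eq m n a b ha div_b u0 us us_uniq us_b us_all hb).
pose gens := [seq natZ (a i) | i <- enum 'I_n].
(* The right-hand side as a sum over all subsets; those not leaving a multiple of [b] contribute
   0. *)
pose F y : int := \sum_(A : {set 'I_n})
  (-1) ^+ #|A| * neg_binomial m b r (y - \sum_(i in A) natZ (a i)).
have sum_ge0 (A : {set 'I_n}) : 0 <= weight (\sum_(i in A) natZ (a i)).
  rewrite (big_morph _ (weightD m) (weight0 m)) sumr_ge0 // => i _.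
  exact: weight_natZ_ge0.
have hF : diffs (nseq r v) F = diffs gens (fun x => (x == 0)%:R).
  apply/funext => y; rewrite diffs_sum diffs_subsets.
  by apply: eq_bigr => A _; rewrite diffs_neg_binomial.
have hmu : diffs (nseq r v) (mobius a) = diffs gens (fun x => (x == 0)%:R).
  apply: (diffs_mobius m n a _ _ (count_fact a predT)) => //.
  - by move=> w; rewrite mem_nseq => /andP[_ /eqP ->]; lia.
  - by move=> w /mapP[i _ ->]; apply: weight_natZ_ge0.
  - by apply/funext => y; apply: diffs_gens_count_fact.
  (* Every member of [us] has degree [b], so $D_b^r$ is the product of the differences attached to
     [us]. *)
  have -> : nseq r v = [seq natZ (sdeg a u) | u <- us].
    apply/esym; rewrite /r -(size_map (fun u => natZ (sdeg a u))).
    by apply/all_pred1P; rewrite all_map; apply/allP => u /us_b[hu _ _] /=; rewrite hu.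
  rewrite diffs_count_fact //; last first.
    exact: (factorizations_pairwise m n a b ha div_b u0 us us_uniq us_b).
  apply/funext => y; apply: count_reduced.
    move=> al.
    have [nu [? ? _]] := reduced_exists m n a b ha div_b u0 us us_b hb al.
    by exists nu.
  exact: (reduced_unique m n a b div_b u0 us us_all hb).
rewrite (diffs_nseq_inj m r v (mobius a) F v_gt0 _ (etrans hmu (esym hF))) => [|y hy].
  rewrite [RHS]big_mkcond; apply: eq_bigr => A _.
  have mE : (exists k, betti_multiple a b x A k) =
      multiple m b (x - \sum_(i in A) natZ (a i)) by [].
  rewrite /neg_binomial -mE; case: ifP => _; last by rewrite mulr0.
  have nE k : (k + n - d = k + r)%N by rewrite {1}hn addnA addnK.
  by rewrite nE.
(* Both functions vanish at negative weight: subtracting generators lowers the weight further, while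
   multiples of [b] have nonnegative weight. *)
rewrite mobius_eq0 => [|/weight_semigroup_ge0]; last by lia.
rewrite /F big1 // => A _; rewrite neg_binomial_out ?mulr0 // => -[k].
move=> /(congr1 weight); rewrite weightB weightMn.
have := sum_ge0 A; rewrite -/v; nia.
Qed.
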